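(* Let $(X,\|\cdot\|)$ be uniformly convex with modulus $\eta$. Let $(x_n),(y_n)$ be the sequences generated by the stochastic Halpern-Mann iteration $$y_n:=(1-\alpha_n)(Tx_n+\xi_n)+\alpha_nu,\qquad x_{n+1}:=(1-\beta_n)(Uy_n+\delta_n)+\beta_ny_n .$$ Let $p\in X$ be a common fixed point of $T$ and $U$, let $K_0>0$ satisfy $K_0\ge\mathbb{E}[\|x_0-p\|]$ and $K_0\ge\mathbb{E}[\|u-p\|]$, let $D\ge\sum_{n=0}^\infty\mathbb{E}[\|\delta_n\|]$ and $E\ge\sum_{n=0}^\infty\mathbb{E}[\|\xi_n\|]$ be real numbers, and put $K:=4K_0+2D+2E$. Suppose that $M_0\in\mathbb{N}^*$ satisfies $\mathbb{E}[\|Tx_n-u\|],\mathbb{E}[\|Uy_n-y_n\|],\mathbb{E}[\|Uu-u\|],\mathbb{E}[\|Uy_n-u\|]\le M_0$ for all $n$; that $\sum_{n=0}^\infty\alpha_n=\infty$ with rate of divergence $\theta$; that $$\sum_{n=0}^\infty \mathbb{E}[\|\xi_{n+1}-\xi_n\|],\quad \sum_{n=0}^\infty\mathbb{E}[\|\delta_{n+1}-\delta_n\|],\quad \sum_{n=0}^\infty|\alpha_{n+1}-\alpha_n|,\quad \sum_{n=0}^\infty|\beta_{n+1}-\beta_n|$$ are all finite with rates of convergence $\sigma_1,\sigma_2,\sigma_3,\sigma_4$ and upper bounds $B_1,B_2,B_3,B_4$, respectively; and that $\mathbb{E}[\|\xi_n\|]\le E_0$, $\mathbb{E}[\|\delta_n\|]\le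 D_0$ for all $n$. Let $\Delta$ be the rate for $\mathbb{E}[\|x_{n+1}-x_n\|]\to0$ given by $$\Delta(\varepsilon):=\theta\left(\sigma\left(\tfrac{\varepsilon}{2}\right),\ln\left(\tfrac{2M}{\varepsilon}\right)\right)+1,\qquad M:=2M_0+E_0+D_0+B_1+B_2+B_3(E_0+M_0)+B_4(D_0+M_0),$$ $$\sigma(\varepsilon):=\max\left\{\sigma_1\left(\tfrac{\varepsilon}{4}\right),\sigma_2\left(\tfrac{\varepsilon}{4}\right),\sigma_3\left(\tfrac{\varepsilon}{4(E_0+M_0)}\right),\sigma_4\left(\tfrac{\varepsilon}{4(D_0+M_0)}\right)\right\}.$$ Also, let $\rho$ be a rate for $\alpha_n\to0$ and assume that $\sum_{n=0}^\infty\mathbb{E}[\|\xi_n\|]<\infty$ and $\sum_{n=0}^\infty\mathbb{E}[\|\delta_n\|]<\infty$ with rates of convergence $\chi_1$ and $\chi_2$, respectively. Let $\Lambda>0$ be such that $\Lambda\le\beta_n\le1-\Lambda$ for all $n\in\mathbb{N}$. Lastly, let $\mu$ be a modulus of uniform integrability for $(\|Uy_n-y_n\|)$. Then $\mathbb{E}[\|Uy_n-y_n\|]\to0$ with rate $$\Gamma(\varepsilon):=\max\left\{\Delta(\overline\varepsilon),\rho\left(\tfrac{\widehat\varepsilon}{4K'}\right),\chi_1(\overline\varepsilon),\chi_2(\overline\varepsilon)\right\}$$ where $\overline\varepsilon:=\widehat\varepsilon\,\mu(\varepsilon/4)/36$, $\widehat\varepsilon:=\frac{\varepsilon}{2}\cdot\Lambda^2\cdot\eta\left(\frac{\varepsilon}{2K'}\right)$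 and $K':=3K/\mu(\varepsilon/4)$.
   Context: $\mathbb{N}=\{0,1,2,\dots\}$, $\mathbb{N}^*=\mathbb{N}\setminus\{0\}$. $(\Omega,\mathcal{F},\mathbb{P})$ is a probability space, $(X,\|\cdot\|)$ is a separable real normed space, and an $X$-valued random variable is a measurable function $\Omega\to X$. $T,U:X\to X$ are nonexpansive ($\|Tx-Ty\|\le\|x-y\|$, $\|Ux-Uy\|\le\|x-y\|$ for all $x,y\in X$); $x_0$ (the starting point) and $u$ (the anchor) are $X$-valued random variables; $(\xi_n),(\delta_n)$ are sequences of $X$-valued random variables; $(\alpha_n),(\beta_n)\subseteq[0,1]$ are deterministic. A modulus of uniform convexity for $X$ is a function $\eta:(0,2]\to(0,1]$ such that for all $\varepsilon\in(0,2]$ and all $x,y$ in the closed unit ball, $\|x-y\|\ge\varepsilon$ implies $\|\frac{x+y}{2}\|\le1-\eta(\varepsilon)$; $X$ is uniformly convex (with modulus $\eta$) if such an $\eta$ exists. By convention $\eta(t):=\eta(2)$ for $t>2$. A modulus of uniform integrability for a sequence of random variables $(X_n)$ with $\sup_n\mathbb{E}[|X_n|]<\infty$ is a function $\mu:(0,\infty)\to(0,\infty)$ such that for all $\varepsilon>0$, $n\in\mathbb{N}$ and $A\in\mathcal{F}$: $\mathbb{P}(A)\le\mu(\varepsilon)$ implies $\mathbb{E}[|X_n|1_A]\le\varepsilon$. Rates. For nonnegative reals $(a_n)$: a rate for $a_n\to0$ is a function $\varphi:(0,\infty)\to\mathbb{N}$ with $a_n<\varepsilon$ for all $\varepsilon>0$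 and $n\ge\varphi(\varepsilon)$. A rate of convergence for $\sum_{n=0}^\infty a_n<\infty$ is a function $\chi:(0,\infty)\to\mathbb{N}$ with $\sum_{n=\chi(\varepsilon)}^\infty a_n<\varepsilon$ for all $\varepsilon>0$. A rate of divergence for $\sum_{n=0}^\infty a_n=\infty$ is a function $\theta:\mathbb{N}\times(0,\infty)\to\mathbb{N}$ with $\sum_{n=k}^{\theta(k,b)}a_n\ge b$ for all $b>0$, $k\in\mathbb{N}$ (so $\theta(k,b)\ge k$); by convention $\theta(k,b):=k$ for $b\le0$. *)

(* Defs.v *)
From mathcomp Require Import all_boot all_order all_algebra.
From mathcomp Require Import all_classical all_reals all_analysis.

Set Implicit Arguments.
Unset Strict Implicit.
Unset Printing Implicit Defensive.
Import Order.TTheory GRing.Theory Num.Theory numFieldNormedType.Exports.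

Local Open Scope classical_set_scope.
Local Open Scope ring_scope.

Definition separable (T : topologicalType) : Prop :=
  exists2 S : set T, countable S & dense S.

Section Geometry.
Context {R : realType} {X : normedModType R}.

Definition nonexpansive (T : X -> X) : Prop :=
  forall x y : X, `|T x - T y| <= `|x - y|.

(* Only the values of [eta] on ]0, 2] are constrained; see [eta_ext]. *)
Definition uniform_convexity_modulus (eta : R -> R) : Prop :=
  forall eps : R, 0 < eps <= 2 ->
    0 < eta eps <= 1 /\
    forall x y : X, `|x| <= 1 -> `|y| <= 1 -> eps <= `|x - y| ->
      `|2^-1 *: (x + y)| <= 1 - eta eps.

End Geometry.
Arguments uniform_convexity_modulus {R} X eta.

(* The convention eta(t) := eta(2) for t > 2. *)
Definition eta_ext {R : realType} (eta : R -> R) (t : R) : R :=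
  if 2 < t then eta 2 else eta t.

Section Rates.
Context {R : realType}.

(* Sequences are extended-real valued so that expectations can be used without
   presupposing integrability. Rates are constrained on positive arguments
   only. *)
Definition rate_to0 (a : nat -> \bar R) (phi : R -> nat) : Prop :=
  forall eps : R, 0 < eps ->
    forall n : nat, (phi eps <= n)%N -> (a n < eps%:E)%E.

Definition summable_with_rate (a : nat -> \bar R) (chi : R -> nat) : Prop :=
  (\sum_(0 <= n <oo) a n < +oo)%E /\
  forall eps : R, 0 < eps -> (\sum_(chi eps <= n <oo) a n < eps%:E)%E.

Definition divergence_rate (a : nat -> R) (theta : nat -> R -> nat) : Prop :=
  forall (k : nat) (b : R), 0 < b ->
    b <= \sum_(k <= n < (theta k b).+1) a n.

(* The convention theta(k, b) := k for b <= 0. *)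
Definition theta_ext (theta : nat -> R -> nat) (k : nat) (b : R) : nat :=
  if b <= 0 then k else theta k b.

End Rates.

Section Probability.
Context {d : measure_display} {Omega : measurableType d} {R : realType}.
Variable P : probability Omega R.

Definition uniform_integrability_modulus (Z : nat -> Omega -> R)
    (mu : R -> R) : Prop :=
  forall eps : R, 0 < eps ->
    0 < mu eps /\
    forall (n : nat) (A : set Omega), measurable A ->
      (P A <= (mu eps)%:E)%E ->
      ('E_P[fun w => (`|Z n w| * \1_A w)%R] <= eps%:E)%E.

Context {X : normedModType R}.

Definition random_vector (f : Omega -> X) : Prop :=
  measurable_fun [set: Omega] (f : Omega -> g_sigma_algebraType (@open X)).

Definition mean_norm (f : Omega -> X) : \bar R := 'E_P[fun w => `|f w|].

End Probability.

Definition halpern_mann {Omega : Type} {R : realType} {X : normedModType R}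
    (T U : X -> X) (alpha beta : nat -> R) (xi delta : nat -> Omega -> X)
    (x0 u : Omega -> X) (x y : nat -> Omega -> X) : Prop :=
  forall w : Omega,
    x 0%N w = x0 w /\
    forall n : nat,
      y n w = (1 - alpha n) *: (T (x n w) + xi n w) + alpha n *: u w /\
      x n.+1 w = (1 - beta n) *: (U (y n w) + delta n w) + beta n *: y n w.

(* Main.v *)
Require Import Defs.
From mathcomp Require Import all_boot all_order all_algebra.
From mathcomp Require Import all_classical all_reals all_analysis.
From mathcomp Require Import lra ring.
Import Order.TTheory GRing.Theory Num.Theory numFieldNormedType.Exports.

(** Fix [eps], let [m] be the value of the modulus of uniform integrability at
    [eps / 4], and put [K' = 3 * K / m]. At a point of the probability space
    where [`|y n - p| <= K'] and [`|U (y n) - y n| >= eps / 2], uniform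
    convexity applied to the vectors [U (y n) - p] and [y n - p], rescaled by
    the norm of the second, shows that the Mann step brings the iterate closer
    to [p] by at least [eps_hat], up to the error [delta n]. The Halpern step
    moves it away from [p] by at most [`|xi n| + alpha n * `|u - p|], so that
    [eps_hat] is at most the sum of [`|x n.+1 - x n|], [`|xi n|], [`|delta n|]
    and [alpha n * `|u - p|] ([displacement_pointwise]). For [n >= Gamma eps]
    the mean of this sum is small compared with [eps_hat * m], while the mean
    of [`|y n - p|] is at most [K / 2] ([mean_dist_halpern_le]). Markov's
    inequality, applied to both alternatives at once, bounds the probability
    of [`|U (y n) - y n| >= eps / 2] by [m]. Uniform integrability then bounds
    the mean of [`|U (y n) - y n|] by [eps / 2 + eps / 4]
    ([mean_displacement_lt]).

    What remains is the rate for the means [s n] of the increments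
    [`|x n.+1 - x n|] ([mean_increment_rate]). The two steps give the
    recursive inequality [s n.+1 <= (1 - alpha n.+1) * s n + b n], where [b] is
    summable with an explicit rate. Starting it from [s 0] would
    require a bound on [s 0] in terms of [M0], but the same computation with
    [`|T (x n.+1) - T (x n)|] estimated through the anchor gives
    [s n.+1 <= (1 - alpha n.+1) * (2 * M0) + b n], so that it can be started
    anywhere. Unfolding from [N] yields the product of the [1 - alpha i] over
    [N < i <= m.+1], whereas the rate of divergence controls the sum of
    [alpha i] over [N <= i <= m]. The shift costs a factor
    [expR (alpha N - alpha m.+1)], which the total variation of [alpha] beyond
    [N] keeps close to [1]. The constant [M] contains the sums of all the
    errors, and this leaves just enough room to absorb that factor
    ([halpern_product_bound]). *)

Set Implicit Arguments.
Unset Strict Implicit.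
Unset Printing Implicit Defensive.

Local Open Scope classical_set_scope.
Local Open Scope ring_scope.

(** * Uniform convexity along a segment *)

Section UniformConvexity.
Context {R : realType} {X : normedModType R}.

Lemma normrZ_ge0 (k : R) (v : X) : 0 <= k -> `|k *: v| = k * `|v|.
Proof. by move=> k0; rewrite normrZ ger0_norm. Qed.

(** The point of parameter [b] is a convex combination, with weight [2 * L] on
    the midpoint, of the midpoint and the two ends. Only the midpoint gains. *)
Lemma uniform_convexity_segment (eta : R -> R) (eps L b : R) (v w : X) :
  uniform_convexity_modulus X eta -> 0 < eps <= 2 ->
  0 <= L -> L <= b <= 1 - L ->
  `|v| <= 1 -> `|w| <= 1 -> eps <= `|v - w| ->
  `|(1 - b) *: v + b *: w| <= 1 - 2 * L * eta eps.
Proof.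
move=> uc eps02 L0 /andP[Lb bL] v1 w1 vw.
have [_ /(_ v w v1 w1 vw) mid] := uc _ eps02.
have -> : (1 - b) *: v + b *: w =
    (2 * L) *: (2^-1 *: (v + w)) + ((1 - b - L) *: v + (b - L) *: w).
  rewrite scalerA mulrAC divff// mul1r scalerDr addrACA -!scalerDl.
  by congr (_ *: _ + _ *: _); ring.
have := ler_normD ((2 * L) *: (2^-1 *: (v + w)))
                  ((1 - b - L) *: v + (b - L) *: w).
have := ler_normD ((1 - b - L) *: v) ((b - L) *: w).
rewrite !normrZ_ge0; try lra.
move: mid v1 w1; rewrite normrZ_ge0; last lra.
set c := 2^-1 * _; set p := `|v|; set q := `|w|.
move=> cle p1 q1 h1 h2.
nra.
Qed.

(** Rescaling by [`|w|] itself, rather than by the bound [K'], makes the gain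
    relative to [`|w|]; since [`|w|^-1 >= K'^-1], the rescaled vectors are
    still at distance at least [eps / (2 * K')], which is where [eta] is
    evaluated. As [`|v - w| <= 2 * `|w|], the norm of [w] is at least [eps / 4],
    which turns the relative gain into an absolute one. *)
Lemma uniform_convexity_decrease (eta : R -> R) (K' eps L b : R) (v w : X) :
  uniform_convexity_modulus X eta -> 0 < K' -> 0 < eps ->
  0 < L -> L <= b <= 1 - L ->
  `|v| <= `|w| -> `|w| <= K' -> eps / 2 <= `|v - w| ->
  eps / 2 * L ^+ 2 * eta_ext eta (eps / (2 * K')) <=
    `|w| - `|(1 - b) *: v + b *: w|.
Proof.
move=> uc K'0 e0 L0 Lb vw wK vwe.
have vw2 : `|v - w| <= `|v| + `|w| := ler_normB v w.
have r0 : eps / 4 <= `|w| by lra.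
have w0 : 0 < `|w| by lra.
have wI : 0 <= `|w|^-1 by rewrite invr_ge0 ltW.
set t := eps / (2 * K').
have t_dist : t <= `|(`|w|^-1 *: v) - (`|w|^-1 *: w)|.
  rewrite -scalerBr normrZ_ge0// mulrC ler_pdivlMr//.
  have -> : t * `|w| = eps / 2 * (`|w| / K') by rewrite /t; field; rewrite gt_eqF.
  by apply: le_trans vwe; rewrite ler_piMr ?ler_pdivrMr ?mul1r//; lra.
have v1 : `| `|w|^-1 *: v| <= 1.
  by rewrite normrZ_ge0// mulrC ler_pdivrMr// mul1r.
have w1 : `| `|w|^-1 *: w| <= 1.
  by rewrite normrZ_ge0// mulVf// gt_eqF.
have t0 : 0 < t by rewrite divr_gt0// mulr_gt0.
have t2 : t <= 2.
  by apply: le_trans t_dist _; have := ler_normB (`|w|^-1 *: v) (`|w|^-1 *: w); lra.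
(* Two vectors of the unit ball are at distance at most 2, so the extension of
   [eta] beyond 2 is never evaluated. *)
rewrite /eta_ext ltNge t2/=.
have t02 : 0 < t <= 2 by rewrite t0.
have := uniform_convexity_segment uc t02 (ltW L0) Lb v1 w1 t_dist.
have -> : (1 - b) *: (`|w|^-1 *: v) + b *: (`|w|^-1 *: w) =
    `|w|^-1 *: ((1 - b) *: v + b *: w).
  by rewrite scalerDr !scalerA; congr (_ *: _ + _ *: _); rewrite mulrC.
rewrite normrZ_ge0// mulrC ler_pdivrMr//.
have [/andP[eta0 _] _] := uc _ t02.
set N := `|_ + _|; set r := `|w| in w0 r0 *; set h := eta t in eta0 *.
move=> hN; have : eps / 2 * L ^+ 2 * h <= 2 * L * h * r.
  have : L * h * (eps / 4) <= L * h * r by rewrite ler_wpM2l// mulr_ge0 ?ltW.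
  have : eps * (L * h) * L <= eps * (L * h) * 1.
    by rewrite ler_wpM2l// ?mulr_ge0// ?ltW//; lra.
  by lra.
lra.
Qed.

End UniformConvexity.

(** * Products of the factors [1 - alpha i] *)

Section Reals.
Context {R : realType}.

Lemma prod_oneB_le_expR (a : nat -> R) (m n : nat) :
  (forall i, a i <= 1) ->
  \prod_(m <= i < n) (1 - a i) <= expR (- \sum_(m <= i < n) a i).
Proof.
move=> a1; rewrite -sumrN expR_sum; apply: ler_prod => i _.
by rewrite subr_ge0 a1/= expR_ge1Dx.
Qed.

Lemma ler_sub_total_variation (a : nat -> R) (m n : nat) : (m <= n)%N ->
  a m - a n <= \sum_(m <= i < n) `|a i.+1 - a i|.
Proof.
move=> mn; rewrite -opprB -(telescope_sumr _ mn).
by rewrite (le_trans _ (ler_norm_sum _ _ _))// ler_normr lexx orbT.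
Qed.

Lemma expR_le1D2x (x : R) : 0 <= x <= 2^-1 -> expR x <= 1 + 2 * x.
Proof.
move=> /andP[x0 x1].
have := expR_ge1Dx (- x); have := expRN x; have := expR_gt0 x.
move: (expR x) (expR (- x)) => p q p0 ->.
rewrite -(ler_pM2r p0) mulVf ?gt_eqF//; nra.
Qed.

(** The product runs over the indices [N.+1] to [m.+1] and the sum in the last
    hypothesis over [N] to [m]. Exchanging one for the other costs the factor
    [expR (a N - a m.+1) <= expR G <= 1 + 2 * G]. When [eps >= 4 * C] the claim
    is immediate. Otherwise [G <= 1 / 2], and the extra term of order [G] is
    compensated by [S], which dominates [C * G] and is counted in [M]. *)
Lemma halpern_product_bound (a : nat -> R) (C S M eps : R) (N m : nat) :
  let G := \sum_(N <= i < m.+1) `|a i.+1 - a i| in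
  (forall i, 0 <= a i <= 1) -> (N <= m)%N -> 0 < eps -> 0 < C ->
  C * G <= S -> C * G < eps / 8 -> S < eps / 2 -> 2 * C + S <= M ->
  (eps < 2 * M -> ln (2 * M / eps) <= \sum_(N <= i < m.+1) a i) ->
  2 * C * \prod_(N <= i < m.+1) (1 - a i.+1) + S < eps.
Proof.
move=> G a01 Nm eps0 C0 CGS CGe Se CSM hln.
have G0 : 0 <= G by rewrite sumr_ge0.
have a0 i : 0 <= a i by case/andP: (a01 i).
have a1 i : a i <= 1 by case/andP: (a01 i).
set Pi := \prod_(_ <= _ < _) _.
have Pi1 : Pi <= 1.
  by apply: prodr_ile1 => i _; rewrite subr_ge0 a1/= gerBl.
have [Ce|Ce] := leP (4 * C) eps.
  have : 2 * C * Pi <= 2 * C by rewrite ler_piMr//; lra.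
  lra.
have S0 : 0 <= S by apply: le_trans CGS; rewrite mulr_ge0 // ltW.
have M0 : 0 < 2 * M by lra.
have PiM : Pi <= (1 + 2 * G) * (eps / (2 * M)).
  have G2 : G <= 2^-1 by nra.
  apply: (le_trans (@prod_oneB_le_expR (fun i => a i.+1) _ _ (fun i => a1 i.+1))).
  have -> : \sum_(N <= i < m.+1) a i.+1 =
      \sum_(N <= i < m.+1) a i - (a N - a m.+1).
    rewrite opprB -telescope_sumr ?leqW// -big_split/=.
    by apply: eq_bigr => i _; rewrite addrC subrK.
  rewrite opprB expRD ler_pM ?expR_ge0//.
    apply: le_trans (expR_le1D2x _); last by rewrite G0.
    by rewrite ler_expR ler_sub_total_variation// leqW.
  rewrite -[eps / _]invrK invf_div -[X in X^-1]lnK ?posrE ?divr_gt0//.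
  by rewrite -expRN ler_expR lerN2 hln//; lra.
have : 2 * M * Pi <= (1 + 2 * G) * eps.
  by rewrite mulrC -ler_pdivlMr// -mulrA.
have Pi0 : 0 <= Pi by rewrite /Pi; apply: prodr_ge0 => i _; rewrite subr_ge0.
move=> h.
have : 2 * (2 * C + S) * Pi <= (1 + 2 * G) * eps.
  by apply: le_trans h; rewrite ler_wpM2r//; lra.
move=> {}h; rewrite -subr_gt0.
(* With [g = C * G] the claim reduces to positivity of a concave quadratic in
   [S] on the interval from [g] to [eps / 2]; the products below certify it. *)
have H : 0 < (2 * C + S) * (eps - (2 * C * Pi + S)).
  move: h CGS CGe; have : 0 <= C * G by rewrite mulr_ge0// ltW.
  have -> : (1 + 2 * G) * eps = eps + 2 * G * eps by ring.
  set g := C * G => g0 h gS ge.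
  have {}h : C * (2 * (2 * C + S) * Pi) <= C * eps + 2 * g * eps.
    have -> : C * eps + 2 * g * eps = C * (eps + 2 * G * eps) by rewrite /g; ring.
    by rewrite ler_wpM2l// ltW.
  have h1 : 0 < (C - eps / 4) * (eps - 2 * S) by rewrite mulr_gt0//; lra.
  have h2 : 0 <= (S - g) * (eps / 2 - S) by rewrite mulr_ge0//; lra.
  have h3 : 0 <= g * (eps / 2 - S) by rewrite mulr_ge0//; lra.
  have h4 : 0 < eps * (eps / 8 - g) by rewrite mulr_gt0//; lra.
  nra.
by rewrite pmulr_rgt0 in H; [|lra].
Qed.

End Reals.

(** * Random vectors in a separable space *)

Section RandomVectors.
Context {d : measure_display} {Omega : measurableType d} {R : realType}.
Context {X : normedModType R}.
Implicit Types f g : Omega -> X.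

Lemma random_vector_preimage f (O : set X) :
  random_vector f -> open O -> measurable (f @^-1` O).
Proof.
move=> mf oO; rewrite -[_ @^-1` _]setTI; apply: mf => //.
exact: sub_sigma_algebra.
Qed.

Lemma random_vectorP f :
  (forall O : set X, open O -> measurable (f @^-1` O)) -> random_vector f.
Proof.
move=> mf; apply: (@measurability _ _ Omega (g_sigma_algebraType (@open X)) _ f (@open X)) => [//|_ [W oW] <-].
by rewrite setTI; exact: mf.
Qed.

Lemma separable_sequence :
  separable X -> exists s : nat -> X, forall (z : X) (e : R), 0 < e ->
    exists i, ball z e (s i).
Proof.
case=> S cS dS.
have [s sS] : exists s : nat -> X, set_surj [set: nat] S s.
  by apply/pcard_surjP.
exists s => z e e0.
have [|t [zt St]] := dS (ball z e) _ (ball_open z e); last first.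
  by have [i _ it] := sS _ St; exists i; rewrite it.
by exists z; exact: ballxx.
Qed.

(** This is where separability matters: an open set of [X * X] is a countable
    union of products of two balls with centres in a fixed dense sequence and
    radius [n.+1%:R^-1], so [f] and [g] are jointly measurable for the Borel
    sets of the product topology. *)
Lemma measurable_pair_open f g (W : set (X * X)) : separable X ->
  random_vector f -> random_vector g -> open W ->
  measurable [set w | W (f w, g w)].
Proof.
move=> /separable_sequence[s sP] mf mg oW.
pose r (n : nat) : R := n.+1%:R^-1.
have r0 n : 0 < r n by rewrite invr_gt0.
pose B (t : nat * nat * nat) : set (X * X) :=
  [set z | ball (s t.1.1) (r t.2) z.1 /\ ball (s t.1.2) (r t.2) z.2].
pose F (t : nat * nat * nat) : set Omega := if `[< B t `<=` W >]
  then f @^-1` ball (s t.1.1) (r t.2) `&` g @^-1` ball (s t.1.2) (r t.2)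
  else set0.
rewrite (_ : [set w | _] = \bigcup_t F t).
  apply: countable_bigcupT_measurable => [|t]; first exact: countableP.
  rewrite /F; case: ifP => // _.
  by apply: measurableI; apply: random_vector_preimage => //; exact: ball_open.
apply/seteqP; split => w /=; last first.
  by move=> [t _]; rewrite /F; case: asboolP => // BW [fw gw]; exact: BW.
move=> Ww.
have /nbhs_ballP[e /= e0 eW] : nbhs (f w, g w) W by exact: open_nbhs_nbhs.
have [n ne] : exists n, r n < e / 2.
  have e20 : 0 < e / 2 by rewrite divr_gt0.
  have [n _ nP] := near_infty_natSinv_lt (PosNum e20).
  by exists n; exact: (nP n (leqnn n)).
have [i fi] := sP (f w) _ (r0 n); have [j gj] := sP (g w) _ (r0 n).
exists (i, j, n) => //; rewrite /F asboolT /=.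
  by split; apply: ball_sym.
move=> [a b] [/= ia jb]; apply: eW; split => /=.
  apply: le_ball (ball_triangle fi ia); have := ne; lra.
apply: le_ball (ball_triangle gj jb); have := ne; lra.
Qed.

Lemma random_vector_continuous2 (h : X * X -> X) f g : separable X ->
  continuous h -> random_vector f -> random_vector g ->
  random_vector (fun w => h (f w, g w)).
Proof.
move=> sX ch mf mg; apply: random_vectorP => O oO.
apply: (@measurable_pair_open _ _ (h @^-1` O)) => //.
exact: (continuousP _).1.
Qed.

Lemma random_vector_comp (h : X -> X) f :
  continuous h -> random_vector f -> random_vector (fun w => h (f w)).
Proof.
move=> ch mf; apply: random_vectorP => O oO.
apply: (@random_vector_preimage _ (h @^-1` O)) => //.
exact: (continuousP _).1.
Qed.

Lemma random_vector_cst (z : X) : random_vector (fun _ : Omega => z).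
Proof. exact: measurable_cst. Qed.

Lemma random_vectorD f g : separable X ->
  random_vector f -> random_vector g -> random_vector (fun w => f w + g w).
Proof.
move=> sX; apply: (@random_vector_continuous2 (fun z => z.1 + z.2)) => //.
exact: add_continuous.
Qed.

Lemma random_vectorZ (k : R) f :
  random_vector f -> random_vector (fun w => k *: f w).
Proof. apply: random_vector_comp; exact: scaler_continuous. Qed.

Lemma random_vectorB f g : separable X ->
  random_vector f -> random_vector g -> random_vector (fun w => f w - g w).
Proof.
move=> sX mf mg; apply: random_vectorD => //.
by apply: random_vector_comp mg; exact: opp_continuous.
Qed.

Lemma random_vector_segment (a : R) f g : separable X ->
  random_vector f -> random_vector g ->
  random_vector (fun w => (1 - a) *: f w + a *: g w).
Proof. by move=> sX mf mg; apply: random_vectorD => //; exact: random_vectorZ. Qed.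

Lemma nonexpansive_continuous (T : X -> X) : nonexpansive T -> continuous T.
Proof.
move=> neT x; apply/cvgrPdist_lt => e e0; near=> z.
apply: (le_lt_trans (neT _ _)); near: z.
by apply: cvgr_dist_lt => //; exact: cvg_id.
Unshelve. all: by end_near. Qed.

Lemma random_vector_nonexpansive (S : X -> X) f :
  nonexpansive S -> random_vector f -> random_vector (fun w => S (f w)).
Proof. by move=> neS; apply: random_vector_comp; exact: nonexpansive_continuous. Qed.

Lemma random_vector_norm f :
  random_vector f -> measurable_fun [set: Omega] (fun w => `|f w|).
Proof.
move=> mf; apply: (measurability _ (measurable_realfun.RGenOInfty.measurableE R)).
move=> _ [_ [a ->] <-]; rewrite setTI.
apply: (@random_vector_preimage _ ((fun z : X => `|z|) @^-1` `]a, +oo[)) => //.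
apply: (continuousP _).1; first exact: norm_continuous.
exact: interval_open.
Qed.

End RandomVectors.

(** * Upper bounds on expectations *)

Section MeanBounds.
Context {d : measure_display} {Omega : measurableType d} {R : realType}.
Variable P : probability Omega R.
Implicit Types f g : Omega -> R.

(** Bundling measurability and positivity with the bound lets pointwise
    inequalities between norms be turned into inequalities between means by
    the closure rules below, without subtracting extended reals. *)
Definition mean_le f (c : R) : Prop :=
  [/\ measurable_fun [set: Omega] f, (forall w, 0 <= f w) &
      ('E_P[f] <= c%:E)%E].

Lemma mean_leD f g (a b : R) : mean_le f a -> mean_le g b ->
  mean_le (fun w => f w + g w) (a + b).
Proof.
move=> [mf f0 fa] [mg g0 gb]; split.
- exact: measurable_realfun.measurable_funD.
- by move=> w; rewrite addr_ge0.
- move: fa gb; rewrite unlock => fa gb.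
  under eq_integral do rewrite EFinD.
  rewrite ge0_integralD//=.
  + by rewrite EFinD; exact: leeD.
  + by move=> w _; rewrite lee_fin.
  + exact/measurable_realfun.measurable_EFinP.
  + by move=> w _; rewrite lee_fin.
  + exact/measurable_realfun.measurable_EFinP.
Qed.

Lemma mean_leZ f (k a : R) : 0 <= k -> mean_le f a ->
  mean_le (fun w => k * f w) (k * a).
Proof.
move=> k0 [mf f0 fa]; split.
- exact: measurable_realfun.measurable_funM.
- by move=> w; rewrite mulr_ge0.
- move: fa; rewrite unlock => fa.
  under eq_integral do rewrite EFinM.
  rewrite ge0_integralZl_EFin//=.
  + by rewrite EFinM; apply: lee_wpmul2l; rewrite ?lee_fin.
  + by move=> w _; rewrite lee_fin.
  + exact/measurable_realfun.measurable_EFinP.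
Qed.

Lemma mean_le_mono f g (a : R) : measurable_fun [set: Omega] g ->
  (forall w, 0 <= g w <= f w) -> mean_le f a -> mean_le g a.
Proof.
move=> mg gf [mf f0 fa]; have g0 w : 0 <= g w by case/andP: (gf w).
split => //; apply: le_trans fa; rewrite unlock.
apply: ge0_le_integral => //=.
- by move=> w _; rewrite lee_fin.
- exact/measurable_realfun.measurable_EFinP.
- exact/measurable_realfun.measurable_EFinP.
- by move=> w _; rewrite lee_fin; case/andP: (gf w).
Qed.

Lemma mean_le_weaken f (a b : R) : a <= b -> mean_le f a -> mean_le f b.
Proof. by move=> ab [mf f0 fa]; split=> //; apply: le_trans fa _; rewrite lee_fin. Qed.

Lemma mean_le_ge0 f (a : R) : mean_le f a -> 0 <= a.
Proof.
case=> _ f0; rewrite -lee_fin; apply: le_trans.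
by rewrite unlock; apply: integral_ge0 => w _; rewrite lee_fin.
Qed.

Lemma mean_le_cst (c : R) : 0 <= c -> mean_le (fun=> c) c.
Proof.
move=> c0; split => //.
rewrite unlock integral_cst//.
(* [P] occurs in the goal as a measure rather than as a probability: the
   two forms are only convertible. *)
have c1 : (c%:E * P [set: Omega])%E = c%:E by rewrite probability_setT mule1.
by have := lexx c%:E; rewrite -{1}c1.
Qed.

Lemma mean_le_indic (A : set Omega) (c : R) : measurable A ->
  mean_le \1_A c -> (P A <= c%:E)%E.
Proof. by move=> mA [_ _]; rewrite unlock integral_indic// setIT. Qed.

Context {X : normedModType R}.
Implicit Types h : Omega -> X.

Lemma mean_norm_ge0 h : (0 <= mean_norm P h)%E.
Proof. by rewrite /mean_norm unlock; apply: integral_ge0 => w _; rewrite lee_fin. Qed.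

Lemma mean_norm_le h (c : R) : random_vector h ->
  (mean_norm P h <= c%:E)%E -> mean_le (fun w => `|h w|) c.
Proof. by move=> mh hc; split => //; exact: random_vector_norm. Qed.

Lemma mean_norm_fine h : random_vector h -> (mean_norm P h < +oo)%E ->
  mean_le (fun w => `|h w|) (fine (mean_norm P h)).
Proof.
by move=> mh hfin; apply: mean_norm_le => //; rewrite fineK// ge0_fin_numE ?mean_norm_ge0.
Qed.

Lemma mean_le_norm_mono h f (a : R) : random_vector h ->
  (forall w, `|h w| <= f w) -> mean_le f a -> mean_le (fun w => `|h w|) a.
Proof.
move=> mh hf; apply: mean_le_mono; first exact: random_vector_norm.
by move=> w; rewrite normr_ge0 hf.
Qed.

End MeanBounds.

(** * Real partial sums of extended series with a rate *)

Section SeriesTails.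
Context {R : realType}.
Implicit Type a : nat -> \bar R.

Lemma summable_fin a chi i : (forall n, 0 <= a n)%E ->
  summable_with_rate a chi -> (a i < +oo)%E.
Proof.
move=> a0 [sa _]; apply: le_lt_trans sa.
apply: le_trans (nneseries_lim_ge i.+1 (fun n _ _ => a0 n)).
by rewrite big_nat_recr//= leeDr// sume_ge0.
Qed.

Lemma fine_sum_le a N m : (forall n, 0 <= a n)%E -> (forall n, a n < +oo)%E ->
  ((\sum_(N <= i < m) fine (a i))%:E <= \sum_(N <= i <oo) a i)%E.
Proof.
move=> a0 afin; apply: le_trans (nneseries_lim_ge m (fun n _ _ => a0 n)).
by rewrite -sumEFin; apply: lee_sum => i _; rewrite fineK// ge0_fin_numE.
Qed.

Lemma fine_sum_tail a N N' m : (N' <= N)%N ->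
  (forall n, 0 <= a n)%E ->
  \sum_(N <= i < m) fine (a i) <= \sum_(N' <= i < m) fine (a i).
Proof.
move=> NN a0; have [Nm|mN] := leqP N m.
  by rewrite (big_cat_nat NN Nm)/= lerDr sumr_ge0// => i _; rewrite fine_ge0.
by rewrite (big_geq (ltnW mN)) sumr_ge0// => i _; rewrite fine_ge0.
Qed.

Lemma tail_sum_lt a chi eps N m : (forall n, 0 <= a n)%E ->
  summable_with_rate a chi -> 0 < eps -> (chi eps <= N)%N ->
  \sum_(N <= i < m) fine (a i) < eps.
Proof.
move=> a0 sa eps0 cN; rewrite (le_lt_trans (fine_sum_tail m cN a0))//.
rewrite -lte_fin; apply: le_lt_trans (sa.2 _ eps0).
by apply: fine_sum_le => // n; exact: summable_fin sa.
Qed.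

Lemma partial_sum_le a chi B N m : (forall n, 0 <= a n)%E ->
  summable_with_rate a chi -> (\sum_(0 <= i <oo) a i <= B%:E)%E ->
  \sum_(N <= i < m) fine (a i) <= B.
Proof.
move=> a0 sa aB; rewrite (le_trans (fine_sum_tail m (leq0n N) a0))//.
rewrite -lee_fin; apply: le_trans aB.
by apply: fine_sum_le => // n; exact: summable_fin sa.
Qed.

Lemma term_lt a chi eps n : (forall n, 0 <= a n)%E ->
  summable_with_rate a chi -> 0 < eps -> (chi eps <= n)%N ->
  fine (a n) < eps.
Proof. by move=> a0 sa e0 cn; have := tail_sum_lt n.+1 a0 sa e0 cn; rewrite big_nat1. Qed.

Lemma rate_to0_cvg a phi : (forall n, 0 <= a n)%E -> rate_to0 a phi ->
  a n @[n --> \oo] --> 0%E.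
Proof.
move=> a0 ra; have afin n : (phi 1%R <= n)%N -> a n \is a fin_num.
  move=> n1; rewrite ge0_fin_numE//; apply: lt_trans (ra _ ltr01 _ n1) _.
  exact: ltry.
apply/fine_cvgP; split; first by exists (phi 1%R).
apply/cvgrPdist_lt => e e0.
exists (maxn (phi 1%R) (phi e)) => // n /=; rewrite geq_max => /andP[n1 ne].
rewrite sub0r normrN ger0_norm ?fine_ge0//.
by rewrite -lte_fin fineK ?afin// ra.
Qed.

End SeriesTails.

(** * One step of a Halpern or Mann iteration *)

Section OneStep.
Context {R : realType} {X : normedModType R}.
Implicit Types (a b : R) (s t v e p : X).

Lemma normr_segment a s v : 0 <= a <= 1 ->
  `|(1 - a) *: s + a *: v| <= (1 - a) * `|s| + a * `|v|.
Proof.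
move=> /andP[a0 a1]; apply: le_trans (ler_normD _ _) _.
by rewrite !normrZ_ge0// subr_ge0.
Qed.

Lemma segment_sub a s v p :
  (1 - a) *: s + a *: v - p = (1 - a) *: (s - p) + a *: (v - p).
Proof.
by rewrite !scalerBr addrACA -opprD -scalerDl subrK scale1r.
Qed.

Lemma segment_subl a s e v p :
  (1 - a) *: (s + e) + a *: v - p =
  ((1 - a) *: (s - p) + a *: (v - p)) + (1 - a) *: e.
Proof. by rewrite -segment_sub scalerDr -!addrA; congr (_ + _); rewrite addrC -addrA. Qed.

Lemma segment_diff a b s t v e :
  ((1 - b) *: t + b *: e) - ((1 - a) *: s + a *: v) =
  (1 - b) *: (t - s) + b *: (e - v) + (b - a) *: (v - s).
Proof.
rewrite -(subrKA ((1 - b) *: s + b *: v)); congr (_ + _).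
  by rewrite !scalerBr opprD addrACA.
rewrite opprD addrACA -!scalerBl.
have -> : 1 - b - (1 - a) = - (b - a) by ring.
by rewrite scaleNr addrC scalerBr.
Qed.

(** Both half-steps of the iteration have this form: the Halpern step with
    anchor [v = u], and the Mann step with [v] the current point [s]. *)
Lemma halpern_step_fixed a (T : X -> X) s e v p : nonexpansive T -> T p = p ->
  0 <= a <= 1 ->
  `|(1 - a) *: (T s + e) + a *: v - p|
    <= (1 - a) * (`|s - p| + `|e|) + a * `|v - p|.
Proof.
move=> neT Tp a01; rewrite segment_sub.
apply: le_trans (normr_segment _ _ a01) _.
rewrite lerD2r ler_wpM2l//; first by case/andP: a01; rewrite subr_ge0.
rewrite addrAC; apply: le_trans (ler_normD _ _) _.
by rewrite lerD2r -[X in _ - X]Tp neT.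
Qed.

(** The values [t = T s] and [t' = T s'] are kept abstract because
    [`|t' - t|] is estimated in two ways: by nonexpansiveness to contract, and
    through the anchor to start the recursion. *)
Lemma halpern_step_diff a a' t t' e e' v v' : 0 <= a' <= 1 ->
  `|((1 - a') *: (t' + e') + a' *: v') - ((1 - a) *: (t + e) + a *: v)|
    <= (1 - a') * (`|t' - t| + `|e' - e|) + a' * `|v' - v|
       + `|a' - a| * (`|t - v| + `|e|).
Proof.
move=> a01; rewrite segment_diff.
apply: le_trans (ler_normD _ _) _; apply: lerD.
  apply: le_trans (normr_segment _ _ a01) _.
  rewrite lerD2r ler_wpM2l//; first by case/andP: a01; rewrite subr_ge0.
  by rewrite opprD addrACA ler_normD.
rewrite normrZ ler_wpM2l// distrC addrAC.
exact: ler_normD.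
Qed.

End OneStep.

(** * The stochastic Halpern-Mann iteration *)

Section HalpernMann.
Context {d : measure_display} {Omega : measurableType d} {R : realType}.
Context (P : probability Omega R) {X : normedModType R}.
Context (T U : X -> X) (x0 u : Omega -> X) (xi delta : nat -> Omega -> X).
Context (alpha beta : nat -> R) (x y : nat -> Omega -> X) (p : X).
Hypothesis X_separable : separable X.
Hypotheses (T_nonexpansive : nonexpansive T) (U_nonexpansive : nonexpansive U).
Hypotheses (x0_rv : random_vector x0) (u_rv : random_vector u).
Hypothesis xi_rv : forall n, random_vector (xi n).
Hypothesis delta_rv : forall n, random_vector (delta n).
Hypothesis alpha01 : forall n, 0 <= alpha n <= 1.
Hypothesis beta01 : forall n, 0 <= beta n <= 1.
Hypothesis xy_halpern_mann : halpern_mann T U alpha beta xi delta x0 u x y.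

Let yE n w :
  y n w = (1 - alpha n) *: (T (x n w) + xi n w) + alpha n *: u w.
Proof. by have [_ /(_ n)[]] := xy_halpern_mann w. Qed.

Let xE n w :
  x n.+1 w = (1 - beta n) *: (U (y n w) + delta n w) + beta n *: y n w.
Proof. by have [_ /(_ n)[]] := xy_halpern_mann w. Qed.

Lemma halpern_iterate_rv n : random_vector (x n) -> random_vector (y n).
Proof.
move=> mx; rewrite (funext (yE n)); apply: random_vector_segment => //.
by apply: random_vectorD => //; exact: random_vector_nonexpansive.
Qed.

Lemma iterate_rv n : random_vector (x n).
Proof.
elim: n => [|n mx].
  by rewrite (_ : x 0%N = x0)//; apply: funext => w; case: (xy_halpern_mann w).
have my := halpern_iterate_rv mx.
rewrite (funext (xE n)); apply: random_vector_segment => //.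
by apply: random_vectorD => //; exact: random_vector_nonexpansive.
Qed.

Let y_rv n : random_vector (y n) := halpern_iterate_rv (iterate_rv n).

(** ** Boundedness in mean *)

Section Boundedness.
Hypotheses (Tp : T p = p) (Up : U p = p).
Context (K0 : R) (e dl : nat -> R).
Hypothesis K0_x0 : mean_le P (fun w => `|x0 w - p|) K0.
Hypothesis K0_u : mean_le P (fun w => `|u w - p|) K0.
Hypothesis e_xi : forall n, mean_le P (fun w => `|xi n w|) (e n).
Hypothesis dl_delta : forall n, mean_le P (fun w => `|delta n w|) (dl n).

Lemma mean_dist_halpern n (c : R) : K0 <= c ->
  mean_le P (fun w => `|x n w - p|) c ->
  mean_le P (fun w => `|y n w - p|) (c + e n).
Proof.
move=> Kc hx; have [a0 a1] := andP (alpha01 n).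
have a1' : 0 <= 1 - alpha n by rewrite subr_ge0.
have en0 := mean_le_ge0 (e_xi n).
apply: (mean_le_weaken (a := (1 - alpha n) * (c + e n) + alpha n * K0)).
  nra.
apply: mean_le_norm_mono (mean_leD (mean_leZ a1' (mean_leD hx (e_xi n)))
  (mean_leZ a0 K0_u)).
  by apply: random_vectorB => //; exact: random_vector_cst.
by move=> w; rewrite yE; exact: halpern_step_fixed.
Qed.

Lemma mean_dist_mann n (c : R) :
  mean_le P (fun w => `|y n w - p|) c ->
  mean_le P (fun w => `|x n.+1 w - p|) (c + dl n).
Proof.
move=> hy; have [b0 b1] := andP (beta01 n).
have b1' : 0 <= 1 - beta n by rewrite subr_ge0.
have dn0 := mean_le_ge0 (dl_delta n).
apply: mean_le_norm_mono (mean_leD hy (dl_delta n)).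
  by apply: random_vectorB; rewrite //; [exact: iterate_rv|exact: random_vector_cst].
move=> w; rewrite xE.
apply: le_trans (halpern_step_fixed _ _ _ U_nonexpansive Up (beta01 n)) _.
have := normr_ge0 (delta n w); nra.
Qed.

Lemma mean_dist_le n :
  mean_le P (fun w => `|x n w - p|) (K0 + \sum_(0 <= i < n) (e i + dl i)).
Proof.
elim: n => [|n hx].
  rewrite big_geq// addr0; apply: mean_le_norm_mono K0_x0.
    by apply: random_vectorB => //; [exact: iterate_rv|exact: random_vector_cst].
  by move=> w; case: (xy_halpern_mann w) => ->.
rewrite big_nat_recr//= addrA addrA.
apply/mean_dist_mann/mean_dist_halpern => //.
rewrite lerDl sumr_ge0// => i _.
by rewrite addr_ge0 ?(mean_le_ge0 (e_xi i)) ?(mean_le_ge0 (dl_delta i)).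
Qed.

Lemma mean_dist_halpern_le n (D E : R) :
  \sum_(0 <= i < n.+1) e i <= E -> \sum_(0 <= i < n.+1) dl i <= D ->
  mean_le P (fun w => `|y n w - p|) (K0 + D + E).
Proof.
move=> hE hD; have dn0 := mean_le_ge0 (dl_delta n).
apply: mean_le_weaken (mean_dist_halpern _ (mean_dist_le n)).
  move: hE hD; rewrite !big_nat_recr//= big_split/=; lra.
rewrite lerDl sumr_ge0// => i _.
by rewrite addr_ge0 ?(mean_le_ge0 (e_xi i)) ?(mean_le_ge0 (dl_delta i)).
Qed.

End Boundedness.

(** ** Rate for the mean of the increments *)

Section AsymptoticRegularity.
Context (M E0 D0 : R) (dxi ddelta : nat -> R).
Hypothesis M_Tx_u : forall n, mean_le P (fun w => `|T (x n w) - u w|) M.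
Hypothesis M_Uy_y : forall n, mean_le P (fun w => `|U (y n w) - y n w|) M.
Hypothesis E0_xi : forall n, mean_le P (fun w => `|xi n w|) E0.
Hypothesis D0_delta : forall n, mean_le P (fun w => `|delta n w|) D0.
Hypothesis dxi_xi :
  forall n, mean_le P (fun w => `|xi n.+1 w - xi n w|) (dxi n).
Hypothesis ddelta_delta :
  forall n, mean_le P (fun w => `|delta n.+1 w - delta n w|) (ddelta n).

Let b n := dxi n + ddelta n + `|alpha n.+1 - alpha n| * (E0 + M)
  + `|beta n.+1 - beta n| * (D0 + M).

Let dx_rv n : random_vector (fun w => x n.+1 w - x n w).
Proof. by apply: random_vectorB => //; exact: iterate_rv. Qed.

Lemma increment_pointwise n w :
  `|x n.+2 w - x n.+1 w| <=
  ((1 - alpha n.+1) * `|T (x n.+1 w) - T (x n w)| + `|xi n.+1 w - xi n w|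
    + `|alpha n.+1 - alpha n| * (`|T (x n w) - u w| + `|xi n w|))
  + `|delta n.+1 w - delta n w|
  + `|beta n.+1 - beta n| * (`|U (y n w) - y n w| + `|delta n w|).
Proof.
rewrite (xE n.+1 w) {1}(xE n w).
apply: le_trans (halpern_step_diff _ _ _ _ _ _ _ (beta01 n.+1)) _.
rewrite lerD2r.
have Udy := U_nonexpansive (y n.+1 w) (y n w).
have dy : `|y n.+1 w - y n w| <=
    (1 - alpha n.+1) * `|T (x n.+1 w) - T (x n w)| + `|xi n.+1 w - xi n w|
    + `|alpha n.+1 - alpha n| * (`|T (x n w) - u w| + `|xi n w|).
  rewrite !(yE _ w).
  apply: le_trans (halpern_step_diff _ _ _ _ _ _ _ (alpha01 n.+1)) _.
  rewrite lerD2r subrr normr0 mulr0 addr0 mulrDr lerD2l.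
  have := normr_ge0 (xi n.+1 w - xi n w); have := alpha01 n.+1; nra.
apply: (le_trans _ (lerD dy (lexx _))).
have := normr_ge0 (delta n.+1 w - delta n w); have := beta01 n.+1; nra.
Qed.

Lemma mean_increment_step n (c : R) :
  mean_le P (fun w => `|T (x n.+1 w) - T (x n w)|) c ->
  mean_le P (fun w => `|x n.+2 w - x n.+1 w|) ((1 - alpha n.+1) * c + b n).
Proof.
move=> hT; have a1' : 0 <= 1 - alpha n.+1.
  by case/andP: (alpha01 n.+1); rewrite subr_ge0.
have -> : (1 - alpha n.+1) * c + b n =
    ((1 - alpha n.+1) * c + dxi n + `|alpha n.+1 - alpha n| * (M + E0))
    + ddelta n + `|beta n.+1 - beta n| * (M + D0) by rewrite /b; ring.
apply: mean_le_norm_mono (increment_pointwise n) _; first exact: dx_rv.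
apply: mean_leD (mean_leZ (normr_ge0 _) (mean_leD (M_Uy_y n) (D0_delta n))).
apply: mean_leD (ddelta_delta n).
apply: mean_leD (mean_leZ (normr_ge0 _) (mean_leD (M_Tx_u n) (E0_xi n))).
exact: mean_leD (mean_leZ a1' hT) (dxi_xi n).
Qed.

Let Tdx_rv n : random_vector (fun w => T (x n.+1 w) - T (x n w)).
Proof.
by apply: random_vectorB => //; apply: random_vector_nonexpansive => //;
  exact: iterate_rv.
Qed.

Lemma mean_increment_contract n (c : R) :
  mean_le P (fun w => `|x n.+1 w - x n w|) c ->
  mean_le P (fun w => `|x n.+2 w - x n.+1 w|) ((1 - alpha n.+1) * c + b n).
Proof.
by move=> hx; apply: mean_increment_step; apply: mean_le_norm_mono hx.
Qed.

(** Going through the anchor bounds the increment without any knowledge of the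
    previous one, and retains the factor [1 - alpha n.+1]. *)
Lemma mean_increment_anchor n :
  mean_le P (fun w => `|x n.+2 w - x n.+1 w|)
    ((1 - alpha n.+1) * (2 * M) + b n).
Proof.
apply: mean_increment_step; rewrite mulr_natl mulr2n.
apply: mean_le_norm_mono (mean_leD (M_Tx_u n.+1) (M_Tx_u n)) => // w.
by rewrite -(subrKA (u w)) (distrC (T (x n w))) ler_normD.
Qed.

Lemma mean_increment_le N m : (N <= m)%N ->
  mean_le P (fun w => `|x m.+2 w - x m.+1 w|)
    (2 * M * \prod_(N <= i < m.+1) (1 - alpha i.+1) + \sum_(N <= i < m.+1) b i).
Proof.
have b0 i : 0 <= b i.
  have h1 := mean_le_ge0 (dxi_xi i); have h2 := mean_le_ge0 (ddelta_delta i).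
  have h3 := mean_le_ge0 (E0_xi i); have h4 := mean_le_ge0 (D0_delta i).
  have h5 := mean_le_ge0 (M_Tx_u i).
  by rewrite /b !addr_ge0// mulr_ge0// addr_ge0.
move=> /subnKC <-; elim: (m - N)%N => [|k ih].
  rewrite addn0 !big_nat1 mulrC; exact: mean_increment_anchor.
rewrite addnS; apply: mean_le_weaken (mean_increment_contract ih).
have Nk : (N <= (N + k).+1)%N by rewrite -addnS leq_addr.
rewrite (big_nat_recr _ _ _ Nk) (big_nat_recr _ _ (fun i => b i) Nk)/=.
set A := \prod_(_ <= _ < _) _; set S := \sum_(_ <= _ < _) _.
have S0 : 0 <= S by rewrite sumr_ge0.
have := alpha01 (N + k).+2; nra.
Qed.

End AsymptoticRegularity.

(** The tail of the errors from [N] on is below [eps / 2], one quarter for each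
    of the four series; [halpern_product_bound] handles the contracted term. *)
Lemma mean_increment_rate (M E0 D0 B1 B2 B3 B4 : R) (theta : nat -> R -> nat)
    (sigma1 sigma2 sigma3 sigma4 : R -> nat) :
  let Mbound := 2 * M + E0 + D0 + B1 + B2 + B3 * (E0 + M) + B4 * (D0 + M) in
  let sigma (eps : R) : nat :=
    maxn (maxn (sigma1 (eps / 4)) (sigma2 (eps / 4)))
         (maxn (sigma3 (eps / (4 * (E0 + M)))) (sigma4 (eps / (4 * (D0 + M))))) in
  0 < M ->
  (forall n, mean_norm P (fun w => T (x n w) - u w)%R <= M%:E)%E ->
  (forall n, mean_norm P (fun w => U (y n w) - y n w)%R <= M%:E)%E ->
  (forall n, mean_norm P (xi n) <= E0%:E)%E ->
  (forall n, mean_norm P (delta n) <= D0%:E)%E ->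
  divergence_rate alpha theta ->
  summable_with_rate
    (fun n => mean_norm P (fun w => xi n.+1 w - xi n w)%R) sigma1 ->
  summable_with_rate
    (fun n => mean_norm P (fun w => delta n.+1 w - delta n w)%R) sigma2 ->
  summable_with_rate (fun n => `|alpha n.+1 - alpha n|%:E) sigma3 ->
  summable_with_rate (fun n => `|beta n.+1 - beta n|%:E) sigma4 ->
  (\sum_(0 <= n <oo) mean_norm P (fun w => xi n.+1 w - xi n w)%R <= B1%:E)%E ->
  (\sum_(0 <= n <oo) mean_norm P (fun w => delta n.+1 w - delta n w)%R
    <= B2%:E)%E ->
  (\sum_(0 <= n <oo) `|alpha n.+1 - alpha n|%R%:E <= B3%:E)%E ->
  (\sum_(0 <= n <oo) `|beta n.+1 - beta n|%R%:E <= B4%:E)%E ->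
  forall (eps : R) (n : nat), 0 < eps ->
    (theta_ext theta (sigma (eps / 2)) (ln (2 * Mbound / eps)) + 1 <= n)%N ->
    exists2 c, c < eps & mean_le P (fun w => `|x n.+1 w - x n w|) c.
Proof.
move=> Mbound sigma M0 M_Tx_u M_Uy_y E0_xi D0_delta alpha_div
  sum_xi sum_delta sum_alpha sum_beta B1_xi B2_delta B3_alpha B4_beta eps.
case=> [|m] eps0; rewrite addn1 // ltnS; set N := sigma _ => thm.
have dv_rv (v : nat -> Omega -> X) : (forall n, random_vector (v n)) ->
    forall n, random_vector (fun w => v n.+1 w - v n w).
  by move=> mv n; apply: random_vectorB.
have norm0 (v : nat -> Omega -> X) n : (0 <= mean_norm P (v n))%E.
  exact: mean_norm_ge0.
have abs0 (a : nat -> R) n : (0 <= `|a n|%:E)%E by rewrite lee_fin.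
have Tx n : mean_le P (fun w => `|T (x n w) - u w|) M.
  apply: mean_norm_le => //; apply: random_vectorB => //.
  by apply: random_vector_nonexpansive => //; exact: iterate_rv.
have Uy n : mean_le P (fun w => `|U (y n w) - y n w|) M.
  apply: mean_norm_le => //; apply: random_vectorB => //.
  exact: random_vector_nonexpansive.
have xiE n := mean_norm_le (xi_rv n) (E0_xi n).
have deltaD n := mean_norm_le (delta_rv n) (D0_delta n).
have xi0 := norm0 (fun k w => xi k.+1 w - xi k w).
have delta0 := norm0 (fun k w => delta k.+1 w - delta k w).
have dxi n := mean_norm_fine (dv_rv _ xi_rv n) (summable_fin n xi0 sum_xi).
have ddl n :=
  mean_norm_fine (dv_rv _ delta_rv n) (summable_fin n delta0 sum_delta).
have E00 := mean_le_ge0 (xiE 0%N); have D00 := mean_le_ge0 (deltaD 0%N).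
have := fun Nm => mean_increment_le Tx Uy xiE deltaD dxi ddl (N := N) (m := m) Nm.
rewrite !big_split/= -!mulr_suml.
set t1 := \sum_(_ <= _ < _) _; set t2 := \sum_(_ <= _ < _) _.
set G := \sum_(_ <= _ < _) _; set H := \sum_(_ <= _ < _) _ => incr.
have [] : (sigma1 (eps / 2 / 4) <= N)%N /\ (sigma2 (eps / 2 / 4) <= N)%N.
  by rewrite /N /sigma !leq_max !leqnn/= ?orbT.
move=> s1 s2.
have [] : (sigma3 (eps / 2 / (4 * (E0 + M))) <= N)%N /\
    (sigma4 (eps / 2 / (4 * (D0 + M))) <= N)%N.
  by rewrite /N /sigma !leq_max !leqnn/= ?orbT.
move=> s3 s4.
have EM0 : 0 < E0 + M by rewrite ltr_wpDl.
have DM0 : 0 < D0 + M by rewrite ltr_wpDl.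
have e4 : 0 < eps / 2 / 4 by rewrite !divr_gt0.
have e3 (k : R) : 0 < k -> 0 < eps / 2 / (4 * k).
  by move=> k0; rewrite !divr_gt0// mulr_gt0.
have t1e : t1 < eps / 2 / 4 by exact: (tail_sum_lt m.+1 xi0 sum_xi e4 s1).
have t2e : t2 < eps / 2 / 4 by exact: (tail_sum_lt m.+1 delta0 sum_delta e4 s2).
have Ge : G < eps / 2 / (4 * (E0 + M)).
  by exact: (tail_sum_lt m.+1 (abs0 _) sum_alpha (e3 _ EM0) s3).
have He : H < eps / 2 / (4 * (D0 + M)).
  by exact: (tail_sum_lt m.+1 (abs0 _) sum_beta (e3 _ DM0) s4).
have t1B : t1 <= B1 by exact: (partial_sum_le N m.+1 xi0 sum_xi B1_xi).
have t2B : t2 <= B2 by exact: (partial_sum_le N m.+1 delta0 sum_delta B2_delta).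
have GB : G <= B3 by exact: (partial_sum_le N m.+1 (abs0 _) sum_alpha B3_alpha).
have HB : H <= B4 by exact: (partial_sum_le N m.+1 (abs0 _) sum_beta B4_beta).
have t10 : 0 <= t1 by rewrite sumr_ge0// => i _; exact: mean_le_ge0 (dxi i).
have t20 : 0 <= t2 by rewrite sumr_ge0// => i _; exact: mean_le_ge0 (ddl i).
have G0 : 0 <= G by rewrite sumr_ge0.
have H0 : 0 <= H by rewrite sumr_ge0.
have scale (k t : R) : 0 < k -> t < eps / 2 / (4 * k) -> t * k < eps / 8.
  move=> k0; have -> : eps / 2 / (4 * k) = (eps / 8) / k.
    by field; rewrite gt_eqF.
  by rewrite ltr_pdivlMr.
have {}Ge := scale _ _ EM0 Ge; have {}He := scale _ _ DM0 He.
have GB' : G * (E0 + M) <= B3 * (E0 + M) by rewrite ler_pM2r.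
have HB' : H * (D0 + M) <= B4 * (D0 + M) by rewrite ler_pM2r.
have GE0 : 0 <= G * E0 by rewrite mulr_ge0.
have GM0 : 0 <= G * M by rewrite mulr_ge0// ltW.
have HD0 : 0 <= H * (D0 + M) by rewrite mulr_ge0// ltW.
have Se : t1 + t2 + G * (E0 + M) + H * (D0 + M) < eps / 2.
  have -> : eps / 2 = eps / 2 / 4 + eps / 2 / 4 + eps / 8 + eps / 8 by field.
  by rewrite !ltrD.
have MS : 2 * M + (t1 + t2 + G * (E0 + M) + H * (D0 + M)) <= Mbound.
  rewrite /Mbound !addrA !lerD// -[leLHS]addr0 -addrA lerD2l.
  exact: addr_ge0.
have a0 i : 0 <= alpha i by case/andP: (alpha01 i).
(* [theta_ext] departs from [theta] exactly when the logarithm is not positive;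
   when it is positive, the sum that [theta] controls is positive as well, and
   this forces [N <= theta N _]. *)
have lnN : 0 < ln (2 * Mbound / eps) ->
    ln (2 * Mbound / eps) <= \sum_(N <= i < m.+1) alpha i /\ (N <= m)%N.
  move=> ln0; have lnth := alpha_div N _ ln0.
  have Nth : (N <= theta N (ln (2 * Mbound / eps)))%N.
    rewrite leqNgt; apply/negP => thN; move: lnth.
    by rewrite big_geq// leNgt ln0.
  have {}thm : (theta N (ln (2 * Mbound / eps)) <= m)%N.
    by move: thm; rewrite /theta_ext leNgt ln0.
  split; last exact: leq_trans thm.
  apply: le_trans lnth _; rewrite [leRHS](big_cat_nat (leqW Nth))//=.
  by rewrite lerDl sumr_ge0.
have Nm : (N <= m)%N.
  have [ln0|ln0] := leP (ln (2 * Mbound / eps)) 0; last by case: (lnN ln0).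
  by move: thm; rewrite /theta_ext ln0.
have MG : M * G <= G * (E0 + M) by rewrite mulrC mulrDr lerDr.
exists (2 * M * \prod_(N <= i < m.+1) (1 - alpha i.+1)
  + (t1 + t2 + G * (E0 + M) + H * (D0 + M))); last exact: incr.
apply: (halpern_product_bound (M := Mbound)) => //.
- by apply: (le_trans MG); rewrite addrAC lerDr !addr_ge0.
- exact: le_lt_trans MG Ge.
- move=> eM; case: lnN => //; apply: ln_gt0.
  by rewrite ltr_pdivlMr// mul1r.
Qed.

(** ** Rate for the mean displacement under [U] *)

Section DisplacementControl.
Context (eta : R -> R) (Lambda : R).
Hypothesis X_uniformly_convex : uniform_convexity_modulus X eta.
Hypothesis Lambda_gt0 : 0 < Lambda.
Hypothesis Lambda_beta : forall n, Lambda <= beta n <= 1 - Lambda.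
Hypotheses (Tp : T p = p) (Up : U p = p).

(** Uniform convexity makes the Mann step decrease the distance to [p] by the
    left-hand side, up to [delta n]. That distance changes by at most
    [`|x n.+1 - x n|] over the whole step and grows by at most
    [`|xi n| + alpha n * `|u - p|] in the Halpern step. *)
Lemma displacement_pointwise n w (K' eps : R) : 0 < K' -> 0 < eps ->
  `|y n w - p| <= K' -> eps / 2 <= `|U (y n w) - y n w| ->
  eps / 2 * Lambda ^+ 2 * eta_ext eta (eps / (2 * K')) <=
    `|x n.+1 w - x n w| + `|xi n w| + `|delta n w| + alpha n * `|u w - p|.
Proof.
move=> K'0 eps0 yK Uy.
have vw : `|U (y n w) - p| <= `|y n w - p| by rewrite -[X in _ - X]Up U_nonexpansive.
have Uy' : eps / 2 <= `|(U (y n w) - p) - (y n w - p)|.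
  by rewrite opprB addrA subrK.
apply: le_trans (uniform_convexity_decrease X_uniformly_convex K'0 eps0
  Lambda_gt0 (Lambda_beta n) vw yK Uy') _.
have hx : `|x n.+1 w - p| <= `|(1 - beta n) *: (U (y n w) - p)
    + beta n *: (y n w - p)| + `|delta n w|.
  rewrite xE segment_subl; apply: le_trans (ler_normD _ _) _.
  have [b0 b1] := andP (beta01 n).
  by rewrite lerD2l normrZ_ge0 ?subr_ge0// ler_piMl// gerBl.
have hy : `|y n w - p| <= `|x n w - p| + `|xi n w| + alpha n * `|u w - p|.
  rewrite yE.
  apply: le_trans (halpern_step_fixed _ _ _ T_nonexpansive Tp (alpha01 n)) _.
  rewrite lerD2r ler_piMl ?addr_ge0//.
  by case/andP: (alpha01 n) => a0 _; rewrite gerBl.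
have hxx : `|x n w - p| <= `|x n.+1 w - x n w| + `|x n.+1 w - p|.
  by rewrite -(subrKA (x n.+1 w)) (distrC (x n.+1 w)) ler_normD.
lra.
Qed.

Lemma eta_ext_gt0 (t : R) : 0 < t -> 0 < eta_ext eta t.
Proof.
move=> t0; rewrite /eta_ext; have [t2|t2] := ltP 2 t.
  have t02 : 0 < (2 : R) <= 2 by rewrite lexx andbT.
  by have [/andP[]] := X_uniformly_convex t02.
have t02 : 0 < t <= 2 by apply/andP; split.
have [/andP[eta0 _] _] := X_uniformly_convex t02.
exact: eta0.
Qed.

(** On the event [A] that the displacement is at least [eps / 2], either
    [`|y n - p| > K'] or [displacement_pointwise] applies. Hence the indicator
    of [A] is dominated by [`|y n - p| / K'] plus the right-hand side of
    [displacement_pointwise] divided by [hat], and integrating this gives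
    [P A <= m / 6 + m / 12 + m / 48]. *)
Lemma mean_displacement_lt n (K K0 m eps : R) :
  let K' := 3 * K / m in
  let hat := eps / 2 * Lambda ^+ 2 * eta_ext eta (eps / (2 * K')) in
  let bar := hat * m / 36 in
  0 < K -> 0 < m -> 0 < eps -> 4 * K0 <= K ->
  (forall A : set Omega, measurable A -> (P A <= m%:E)%E ->
    ('E_P[fun w => (`|U (y n w) - y n w| * \1_A w)%R] <= (eps / 4)%:E)%E) ->
  mean_le P (fun w => `|x n.+1 w - x n w|) bar ->
  mean_le P (fun w => `|xi n w|) bar ->
  mean_le P (fun w => `|delta n w|) bar ->
  alpha n <= hat / (4 * K') ->
  mean_le P (fun w => `|u w - p|) K0 ->
  mean_le P (fun w => `|y n w - p|) (K / 2) ->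
  (mean_norm P (fun w => U (y n w) - y n w)%R < eps%:E)%E.
Proof.
move=> K' hat bar K_gt0 m0 eps0 K0K ui hdx hxi hdl al hu hy.
have K'0 : 0 < K' by rewrite divr_gt0// mulr_gt0.
have hat0 : 0 < hat.
  rewrite /hat !mulr_gt0 ?exprn_gt0 ?eta_ext_gt0 ?divr_gt0 ?mulr_gt0 ?invr_gt0//.
have Uy_rv : random_vector (fun w => U (y n w) - y n w).
  by apply: random_vectorB => //; exact: random_vector_nonexpansive.
have mUy := random_vector_norm Uy_rv.
pose A := (fun w => `|U (y n w) - y n w|) @^-1` `[eps / 2, +oo[.
have mA : measurable A.
  by rewrite -[A]setTI; apply: mUy => //; exact: measurable_itv.
have PA : (P A <= m%:E)%E.
  apply: (mean_le_indic mA).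
  have [a0 _] := andP (alpha01 n).
  have K'V : 0 <= K'^-1 by rewrite invr_ge0 ltW.
  have hatV : 0 <= hat^-1 by rewrite invr_ge0 ltW.
  apply: (mean_le_weaken (a := K'^-1 * (K / 2)
      + hat^-1 * (bar + bar + bar + alpha n * K0))).
    have -> : K'^-1 * (K / 2) = m / 6.
      by rewrite /K'; field; rewrite !gt_eqF.
    rewrite mulrDr.
    have -> : hat^-1 * (bar + bar + bar) = m / 12.
      by rewrite /bar; field; rewrite gt_eqF.
    have K00 := mean_le_ge0 hu.
    have : hat^-1 * (alpha n * K0) <= m / 48.
      have : alpha n * K0 <= hat / (4 * K') * (K / 4).
        by rewrite ler_pM//; lra.
      have -> : hat / (4 * K') * (K / 4) = hat * (m / 48).
        by rewrite /K'; field; rewrite !gt_eqF.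
      by move=> h; rewrite mulrC ler_pdivrMr// [leRHS]mulrC.
    lra.
  apply: mean_le_mono (mean_leD (mean_leZ K'V hy) (mean_leZ hatV
    (mean_leD (mean_leD (mean_leD hdx hxi) hdl) (mean_leZ a0 hu)))).
    exact: measurable_realfun.measurable_indic.
  move=> w; rewrite indicE; have [|/= _] := boolP (w \in A); last first.
    rewrite mulr0n lexx/=.
    by rewrite addr_ge0// mulr_ge0// ?addr_ge0 ?mulr_ge0.
  rewrite inE /A /= in_itv/= andbT => wA; rewrite mulr1n ler01/=.
  have [yK|yK] := leP `|y n w - p| K'.
    rewrite -[leLHS]add0r lerD ?mulr_ge0// mulrC ler_pdivlMr// mul1r.
    exact: displacement_pointwise.
  rewrite -[leLHS]addr0 lerD ?mulr_ge0 ?addr_ge0// ?mulr_ge0//.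
  by rewrite mulrC ler_pdivlMr// mul1r ltW.
have hA : mean_le P (fun w => `|U (y n w) - y n w| * \1_A w) (eps / 4).
  split; last exact: ui.
    by apply: measurable_realfun.measurable_funM => //; exact: measurable_realfun.measurable_indic.
  by move=> w; rewrite mulr_ge0// indicE ler0n.
have e20 : 0 <= eps / 2 by rewrite divr_ge0// ltW.
have : mean_le P (fun w => `|U (y n w) - y n w|) (eps / 2 + eps / 4).
  apply: mean_le_norm_mono (mean_leD (mean_le_cst P e20) hA) => // w.
  rewrite indicE; have [|wA] := boolP (w \in A); first by rewrite mulr1 lerDr.
  rewrite mulr0 addr0 leNgt; apply/negP => wA'; move/negP: wA; apply.
  by rewrite inE /A /= in_itv/= andbT ltW.
by case=> _ _ hE; apply: le_lt_trans hE _; rewrite lte_fin; lra.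
Qed.

End DisplacementControl.

End HalpernMann.

Theorem theorem3p18
  (d : measure_display) (Omega : measurableType d) (R : realType)
  (P : probability Omega R) (X : normedModType R)
  (T U : X -> X) (x0 u : Omega -> X) (xi delta : nat -> Omega -> X)
  (alpha beta : nat -> R) (x y : nat -> Omega -> X) (p : X)
  (eta : R -> R) (K0 D E E0 D0 B1 B2 B3 B4 Lambda : R) (M0 : nat)
  (theta : nat -> R -> nat)
  (sigma1 sigma2 sigma3 sigma4 rho chi1 chi2 : R -> nat) (mu : R -> R)
  (X_separable : separable X)
  (X_uniformly_convex : uniform_convexity_modulus X eta)
  (T_nonexpansive : nonexpansive T) (U_nonexpansive : nonexpansive U)
  (x0_rv : random_vector x0) (u_rv : random_vector u)
  (xi_rv : forall n, random_vector (xi n))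
  (delta_rv : forall n, random_vector (delta n))
  (alpha01 : forall n, 0 <= alpha n <= 1)
  (beta01 : forall n, 0 <= beta n <= 1)
  (xy_halpern_mann : halpern_mann T U alpha beta xi delta x0 u x y)
  (Tp : T p = p) (Up : U p = p)
  (K0_gt0 : 0 < K0)
  (K0_x0 : (mean_norm P (fun w => x0 w - p)%R <= K0%:E)%E)
  (K0_u : (mean_norm P (fun w => u w - p)%R <= K0%:E)%E)
  (D_delta : (\sum_(0 <= n <oo) mean_norm P (delta n) <= D%:E)%E)
  (E_xi : (\sum_(0 <= n <oo) mean_norm P (xi n) <= E%:E)%E)
  (M0_gt0 : (0 < M0)%N)
  (M0_Tx_u : forall n,
    (mean_norm P (fun w => T (x n w) - u w)%R <= (M0%:R)%:E)%E)
  (M0_Uy_y : forall n,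
    (mean_norm P (fun w => U (y n w) - y n w)%R <= (M0%:R)%:E)%E)
  (M0_Uu_u : (mean_norm P (fun w => U (u w) - u w)%R <= (M0%:R)%:E)%E)
  (M0_Uy_u : forall n,
    (mean_norm P (fun w => U (y n w) - u w)%R <= (M0%:R)%:E)%E)
  (alpha_div : divergence_rate alpha theta)
  (sum_xi : summable_with_rate
    (fun n => mean_norm P (fun w => xi n.+1 w - xi n w)%R) sigma1)
  (sum_delta : summable_with_rate
    (fun n => mean_norm P (fun w => delta n.+1 w - delta n w)%R) sigma2)
  (sum_alpha : summable_with_rate
    (fun n => `|alpha n.+1 - alpha n|%:E) sigma3)
  (sum_beta : summable_with_rate
    (fun n => `|beta n.+1 - beta n|%:E) sigma4)
  (B1_xi : (\sum_(0 <= n <oo) mean_norm P (fun w => xi n.+1 w - xi n w)%R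
    <= B1%:E)%E)
  (B2_delta : (\sum_(0 <= n <oo) mean_norm P (fun w => delta n.+1 w - delta n w)%R
    <= B2%:E)%E)
  (B3_alpha : (\sum_(0 <= n <oo) `|alpha n.+1 - alpha n|%R%:E <= B3%:E)%E)
  (B4_beta : (\sum_(0 <= n <oo) `|beta n.+1 - beta n|%R%:E <= B4%:E)%E)
  (E0_xi : forall n, (mean_norm P (xi n) <= E0%:E)%E)
  (D0_delta : forall n, (mean_norm P (delta n) <= D0%:E)%E)
  (rho_alpha : rate_to0 (fun n => (alpha n)%:E) rho)
  (chi1_xi : summable_with_rate (fun n => mean_norm P (xi n)) chi1)
  (chi2_delta : summable_with_rate (fun n => mean_norm P (delta n)) chi2)
  (Lambda_gt0 : 0 < Lambda)
  (Lambda_beta : forall n, Lambda <= beta n <= 1 - Lambda)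
  (mu_ui : uniform_integrability_modulus P
    (fun n w => `|U (y n w) - y n w|) mu) :
  let K := 4 * K0 + 2 * D + 2 * E in
  let M := 2 * M0%:R + E0 + D0 + B1 + B2
           + B3 * (E0 + M0%:R) + B4 * (D0 + M0%:R) in
  let sigma (eps : R) : nat :=
    maxn (maxn (sigma1 (eps / 4)) (sigma2 (eps / 4)))
         (maxn (sigma3 (eps / (4 * (E0 + M0%:R))))
               (sigma4 (eps / (4 * (D0 + M0%:R))))) in
  let Delta (eps : R) : nat :=
    (theta_ext theta (sigma (eps / 2)) (ln (2 * M / eps)) + 1)%N in
  let K' (eps : R) : R := 3 * K / mu (eps / 4) in
  let eps_hat (eps : R) : R :=
    eps / 2 * Lambda ^+ 2 * eta_ext eta (eps / (2 * K' eps)) in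
  let eps_bar (eps : R) : R := eps_hat eps * mu (eps / 4) / 36 in
  let Gamma (eps : R) : nat :=
    maxn (maxn (Delta (eps_bar eps)) (rho (eps_hat eps / (4 * K' eps))))
         (maxn (chi1 (eps_bar eps)) (chi2 (eps_bar eps))) in
  let a (n : nat) : \bar R :=
    mean_norm P (fun w => U (y n w) - y n w)%R in
  a n @[n --> \oo] --> 0%E /\ rate_to0 a Gamma.
Proof.
move=> K M sigma Delta K' eps_hat eps_bar Gamma a.
suff ra : rate_to0 a Gamma.
  by split => //; apply: rate_to0_cvg ra => n; exact: mean_norm_ge0.
move=> eps eps0 n; rewrite !geq_max => /andP[/andP[nDelta nrho] /andP[nchi1 nchi2]].
have xi0 k : (0 <= mean_norm P (xi k))%E := mean_norm_ge0 P (xi k).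
have delta0 k : (0 <= mean_norm P (delta k))%E := mean_norm_ge0 P (delta k).
have e4 : 0 < eps / 4 by rewrite divr_gt0.
have [mu0 ui] := mu_ui _ e4.
have D0' : 0 <= D.
  by rewrite -lee_fin; apply: le_trans D_delta; exact: nneseries_ge0.
have E0' : 0 <= E.
  by rewrite -lee_fin; apply: le_trans E_xi; exact: nneseries_ge0.
have K_gt0 : 0 < K by rewrite /K; lra.
have K'0 : 0 < K' eps by rewrite /K' divr_gt0// mulr_gt0.
have hat0 : 0 < eps_hat eps.
  rewrite /eps_hat !mulr_gt0 ?exprn_gt0 ?invr_gt0//.
  by apply: (eta_ext_gt0 X_uniformly_convex); rewrite divr_gt0// mulr_gt0.
have bar0 : 0 < eps_bar eps by rewrite /eps_bar divr_gt0// mulr_gt0.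
have cst_rv (z : X) : random_vector (fun _ : Omega => z) := random_vector_cst z.
have hu : mean_le P (fun w => `|u w - p|) K0.
  by apply: mean_norm_le => //; exact: random_vectorB.
have hx0 : mean_le P (fun w => `|x0 w - p|) K0.
  by apply: mean_norm_le => //; exact: random_vectorB.
have hxi k := mean_norm_fine (xi_rv k) (summable_fin k xi0 chi1_xi).
have hdelta k := mean_norm_fine (delta_rv k) (summable_fin k delta0 chi2_delta).
have hy : mean_le P (fun w => `|y n w - p|) (K / 2).
  apply: mean_le_weaken (mean_dist_halpern_le X_separable T_nonexpansive
    U_nonexpansive x0_rv u_rv xi_rv delta_rv alpha01 beta01 xy_halpern_mann
    Tp Up hx0 hu hxi hdelta (partial_sum_le 0 n.+1 xi0 chi1_xi E_xi)
    (partial_sum_le 0 n.+1 delta0 chi2_delta D_delta)).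
  by rewrite /K; lra.
have M00 : 0 < M0%:R :> R by rewrite ltr0n.
have [c cbar hdx] := mean_increment_rate X_separable T_nonexpansive
  U_nonexpansive x0_rv u_rv xi_rv delta_rv alpha01 beta01 xy_halpern_mann
  M00 M0_Tx_u M0_Uy_y E0_xi D0_delta alpha_div sum_xi sum_delta sum_alpha
  sum_beta B1_xi B2_delta B3_alpha B4_beta bar0 nDelta.
have rho0 : 0 < eps_hat eps / (4 * K' eps) by rewrite divr_gt0// mulr_gt0.
apply: (mean_displacement_lt X_separable T_nonexpansive
  U_nonexpansive x0_rv u_rv xi_rv delta_rv alpha01 beta01 xy_halpern_mann
  X_uniformly_convex Lambda_gt0 Lambda_beta Tp Up K_gt0 mu0 eps0 _ _
  (mean_le_weaken (ltW cbar) hdx) _ _ _ hu hy).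
- by rewrite /K; lra.
- move=> A mA PA; apply: le_trans (ui n A mA PA); rewrite le_eqVlt.
  apply/orP; left; apply/eqP; congr expectation.
  by apply: funext => w; rewrite normr_id.
- by apply: mean_le_weaken (hxi n); apply/ltW/(term_lt xi0 chi1_xi).
- by apply: mean_le_weaken (hdelta n); apply/ltW/(term_lt delta0 chi2_delta).
- by rewrite -lee_fin ltW// (rho_alpha _ rho0).
Qed.
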